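(* For every $d\in\mathbb{N}$, the digraph property $\mathrm{RV}$ — the set of digraphs that have a vertex $s$ such that there is a directed path from every vertex to $s$ — is $1$-sided error strongly-testable in the $F(d)$-model.
   Context: The $F(d)$-model consists of all digraphs (no multiple edges) with every out-degree at most $d$; a query to an $n$-vertex digraph specifies a vertex $v$ and returns the set $\Gamma^+(v)$ of its out-neighbours. An $n$-vertex $G$ is $\epsilon$-far from a property if more than $\epsilon dn$ edge deletions/insertions are needed to turn it into an $n$-vertex digraph of the $F(d)$-model having the property. A $1$-sided error $\epsilon$-test accepts every $n$-vertex digraph with the property with probability $1$ and rejects every $\epsilon$-far one with probability at least $1/2$. A property is $1$-sided error strongly-testable if for every $\epsilon\in(0,1)$ it has a $1$-sided error $\epsilon$-test whose number of queries is bounded by a function of $\epsilon$ (and $d$) only, independent of $n$. *)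

(* Defs.v *)
From HB Require Import structures.
From mathcomp Require Import all_boot all_order all_algebra.
From mathcomp Require Import reals.

Set Implicit Arguments.
Unset Strict Implicit.
Unset Printing Implicit Defensive.

Import Order.TTheory GRing.Theory Num.Theory.

Local Open Scope ring_scope.

(* A digraph on the vertex set 'I_n, given by its edge set: multiple edges are
   impossible, antiparallel edges and loops are allowed. *)
Definition digraph (n : nat) : Type := {set 'I_n * 'I_n}.

Definition out_nbrs (n : nat) (G : digraph n) (v : 'I_n) : {set 'I_n} :=
  [set w | (v, w) \in G].

Definition in_F (d n : nat) (G : digraph n) : Prop :=
  forall v : 'I_n, (#|out_nbrs G v| <= d)%N.

Definition digraph_property : Type := forall n : nat, digraph n -> Prop.

Definition RV : digraph_property := fun n (G : digraph n) =>
  exists s : 'I_n, forall v : 'I_n,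
    connect (fun x y : 'I_n => (x, y) \in G) v s.

(* Least number of edge deletions and insertions turning G into H. *)
Definition edit_dist (n : nat) (G H : digraph n) : nat :=
  #|(G :\: H) :|: (H :\: G)|.

(* If no n-vertex digraph of the F(d)-model has the property, then every
   n-vertex digraph is far from it. *)
Definition eps_far (R : realType) (d : nat) (P : digraph_property) (eps : R)
    (n : nat) (G : digraph n) : Prop :=
  forall H : digraph n, in_F d H -> P n H ->
    eps * d%:R * n%:R < (edit_dist G H)%:R.

(* Deterministic adaptive query algorithms on n-vertex digraphs, as decision
   trees: the continuation of a query to v receives the set of out-neighbours
   of v; [Answer true] means acceptance. *)
Inductive query_tree (n : nat) : Type :=
| Answer (accept : bool)
| Query (v : 'I_n) (next : {set 'I_n} -> query_tree n).

Fixpoint accepts (n : nat) (G : digraph n) (t : query_tree n) : bool :=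
  match t with
  | Answer b => b
  | Query v next => accepts G (next (out_nbrs G v))
  end.

Fixpoint num_queries (n : nat) (G : digraph n) (t : query_tree n) : nat :=
  match t with
  | Answer _ => 0%N
  | Query v next => (num_queries G (next (out_nbrs G v))).+1
  end.

(* A randomized query algorithm is a random deterministic one. A finite sample
   space with real weights loses no generality: for fixed n there are only
   finitely many decision trees with a given bound on their depth. *)
Record rand_alg (R : realType) (n : nat) : Type := RandAlg {
  coins : finType;
  weight : coins -> R;
  weight_ge0 : forall c : coins, 0 <= weight c;
  weight_sum1 : \sum_(c : coins) weight c = 1;
  strategy : coins -> query_tree n
}.

Definition Pr_accept (R : realType) (n : nat) (A : rand_alg R n)
    (G : digraph n) : R :=
  \sum_(c : coins A | accepts G (strategy c)) weight c.

Definition Pr_reject (R : realType) (n : nat) (A : rand_alg R n)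
    (G : digraph n) : R :=
  \sum_(c : coins A | ~~ accepts G (strategy c)) weight c.

Definition one_sided_test (R : realType) (d : nat) (P : digraph_property)
    (eps : R) (A : forall n : nat, rand_alg R n) : Prop :=
  forall (n : nat) (G : digraph n), in_F d G ->
    (P n G -> Pr_accept (A n) G = 1) /\
    (eps_far d P eps G -> 1 / 2 <= Pr_reject (A n) G).

Definition queries_at_most (R : realType) (d q : nat)
    (A : forall n : nat, rand_alg R n) : Prop :=
  forall (n : nat) (G : digraph n), in_F d G ->
    forall c : coins (A n), (num_queries G (strategy c) <= q)%N.

Definition one_sided_strongly_testable (R : realType) (d : nat)
    (P : digraph_property) : Prop :=
  exists q : R -> nat, forall eps : R, 0 < eps < 1 ->
    exists A : forall n : nat, rand_alg R n,
      one_sided_test d P eps A /\ queries_at_most d (q eps) A.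

(* Main.v *)
(* A digraph has RV iff it has exactly one sink, that is, one minimal nonempty
   vertex set closed under out-neighbours.  Sinks are pairwise disjoint, and
   redirecting one vertex of each of the k sinks to a common vertex gives RV at
   the cost of at most k(d + 1) edits.  So an eps-far digraph has at least
   eps n / 2 sinks, a positive fraction (in terms of eps) of n of which have at
   most M = O(1 / eps) vertices.  For n > M, a random pair of vertices hits two
   different small sinks with probability at least 1 / (2 M^2), so some of
   2 M^2 independent pairs does with probability at least 1/2.  Exploring M
   steps from each vertex then exhibits two disjoint closed sets, which is a
   certificate against RV.  For n <= M one explores from all vertices. *)
Require Import Defs.
From mathcomp Require Import all_boot all_order all_algebra.
From mathcomp Require Import reals.
From mathcomp Require Import zify.

Set Implicit Arguments.
Unset Strict Implicit.
Unset Printing Implicit Defensive.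

Import Order.TTheory GRing.Theory Num.Theory.

(** * Absorbing sets and sinks *)

Definition absorbing n (G : digraph n) : pred {set 'I_n} :=
  fun C => (C != set0) && [forall v in C, out_nbrs G v \subset C].

(* The vertex sets of the strongly connected components without outgoing
   edges. *)
Definition sinks n (G : digraph n) : {set {set 'I_n}} :=
  [set C | minset (absorbing G) C].

Lemma absorbing_connect n (G : digraph n) C v w :
  absorbing G C -> v \in C -> connect (fun x y => (x, y) \in G) v w -> w \in C.
Proof.
case/andP=> _ /forall_inP clC vC /connectP[p].
elim: p v vC => [v vC _ -> // | x p IHp v vC /= /andP[vx px] defw].
by apply: (IHp x) => //; apply: (subsetP (clC v vC)); rewrite inE.
Qed.

Lemma sinks_absorbing n (G : digraph n) C : C \in sinks G -> absorbing G C.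
Proof. by rewrite inE => /minsetp. Qed.

Lemma sinks_neq0 n (G : digraph n) C : C \in sinks G -> C != set0.
Proof. by move/sinks_absorbing/andP => []. Qed.

(** If two sinks meet, their intersection is absorbing, so by minimality both are equal to it. *)
Lemma sinks_trivIset n (G : digraph n) : trivIset (sinks G).
Proof.
apply/trivIsetP => A B sA sB; apply: contraR.
rewrite -setI_eq0 => AB0.
have abs : absorbing G (A :&: B).
  rewrite /absorbing AB0; apply/forall_inP => v; rewrite inE => /andP[vA vB].
  have /andP[_ /forall_inP clA] := sinks_absorbing sA.
  have /andP[_ /forall_inP clB] := sinks_absorbing sB.
  by rewrite subsetI clA ?clB.
move: sA sB; rewrite !inE => /minsetP[_ minA] /minsetP[_ minB].
by rewrite -(minA _ abs (subsetIl _ _)) (minB _ abs (subsetIr _ _)).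
Qed.

(** The set of vertices reachable from [v] is absorbing, hence contains a minimal absorbing set. *)
Lemma connect_sink n (G : digraph n) v :
  exists2 C, C \in sinks G &
    forall w, w \in C -> connect (fun x y => (x, y) \in G) v w.
Proof.
pose reach := [set w | connect (fun x y => (x, y) \in G) v w].
have absR : absorbing G reach.
  apply/andP; split; first by apply/set0Pn; exists v; rewrite inE connect0.
  apply/forall_inP => x; rewrite inE => vx; apply/subsetP => y; rewrite !inE.
  by move=> xy; apply: (connect_trans vx); apply: connect1.
have [C minC /subsetP sCR] := minset_exists absR.
by exists C => [|w /sCR]; rewrite inE.
Qed.

(** If there were a single sink, every vertex would reach all of it by [connect_sink], and any of
    its vertices would witness [RV]. *)
Lemma not_RV_sinks n (G : digraph n) : (0 < n)%N -> ~ RV G ->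
  exists A B, [/\ A \in sinks G, B \in sinks G & A != B].
Proof.
move=> n_gt0 notRV; have [A sA _] := connect_sink G (Ordinal n_gt0).
have [/exists_inP[B sB nAB]|] := boolP [exists B in sinks G, A != B].
  by exists A, B.
rewrite negb_exists_in => /forall_inP oneA; case: notRV.
have /set0Pn[s sinA] := sinks_neq0 sA; exists s => v.
have [B sB vB] := connect_sink G v; apply: vB.
by have := oneA B sB; rewrite negbK => /eqP <-.
Qed.

(** * Number of sinks and distance to [RV] *)

(** Applied to all sinks to select the vertices to redirect, and to the small sinks to count pairs
    of vertices in different sinks. *)
Lemma exists_transversal n (G : digraph n) (S : {set {set 'I_n}}) :
  S \subset sinks G ->
  exists X : {set 'I_n}, [/\ #|X| = #|S|,
    forall C, C \in S -> exists2 x, x \in X & x \in C &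
    forall x y, x \in X -> y \in X -> x != y ->
      exists A B, [/\ A \in S, B \in S, A != B, x \in A & y \in B]].
Proof.
move=> /subsetP sS.
have triv : trivIset S by apply: trivIsetS (sinks_trivIset G); apply/subsetP.
have n0 : set0 \notin S.
  by apply/negP => /sS/sinks_neq0; rewrite eqxx.
have /transversalP trX : partition S (cover S) by rewrite /partition eqxx triv.
set X := transversal _ _ in trX; have /subsetP sX := transversal_sub trX.
exists X; split=> [|C SC|x y xX yX nxy].
- exact: card_transversal trX.
- move: SC; rewrite -{1}(pblock_transversal trX) => /imsetP[x xX ->].
  by exists x; rewrite // mem_pblock sX.
- exists (pblock S x), (pblock S y); rewrite !pblock_mem ?mem_pblock ?sX //.
  split=> //; apply: contra nxy => /eqP/(pblock_inj trX)-> //.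
Qed.

(* One vertex of each sink is given a single out-neighbour x0 in a fixed sink.
   A path into such a vertex, cut at its first visit, survives. *)
Lemma RV_near n d (G : digraph n) : (0 < n)%N -> (0 < d)%N -> in_F d G ->
  exists H : digraph n,
    [/\ in_F d H, RV H & (edit_dist G H <= #|sinks G| * d.+1)%N].
Proof.
move=> n_gt0 d_gt0 GF.
have [X [cardX meetX _]] := exists_transversal (subxx (sinks G)).
have [C0 sC0 _] := connect_sink G (Ordinal n_gt0).
have [x0 x0X _] := meetX _ sC0.
(* Since [x0] lies in [X] too, its only outgoing edge in [H] is a loop. *)
pose H : digraph n := [set e | if e.1 \in X then e.2 == x0 else e \in G].
exists H; split.
- move=> v; case vX: (v \in X).
    have -> : out_nbrs H v = [set x0] by apply/setP => w; rewrite !inE /= vX.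
    by rewrite cards1.
  have -> : out_nbrs H v = out_nbrs G v by apply/setP => w; rewrite !inE /= vX.
  exact: GF.
- exists x0 => v; have [C sC vC] := connect_sink G v.
  have [x xX /vC /connectP[p]] := meetX _ sC.
  elim: p v {vC} => [v _ defx | w p IHp v /= /andP[vw pw] defx].
    by apply: connect1; rewrite inE /= -[v]defx xX.
  case vX: (v \in X); first by apply: connect1; rewrite inE /= vX.
  by apply: connect_trans (IHp w pw defx); apply: connect1; rewrite inE /= vX.
(* Deleted edges lie in [E1], at most [d] per vertex of [X]; inserted edges go from [X] to [x0], one
   per vertex. *)
- pose E1 := [set e in G | e.1 \in X].
  have cE1 : (#|E1| <= #|X| * d)%N.
    have -> : #|E1| = (\sum_(v in X) \sum_(w in out_nbrs G v) 1)%N.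
      rewrite pair_big_dep /= -sum1_card; apply: eq_bigl => -[v w].
      by rewrite !inE /= andbC.
    by rewrite -sum_nat_const leq_sum // => v _; rewrite sum1_card GF.
  have sub : (G :\: H) :|: (H :\: G) \subset E1 :|: setX X [set x0].
    apply/subsetP => -[v w]; rewrite !inE /=; case: (v \in X) => //=.
      by rewrite !andbT; case: (_ \in G); case: (w == x0).
    by case: (_ \in G).
  apply: leq_trans (subset_leq_card sub) _.
  apply: leq_trans (leq_card_setU _ _) _.
  by rewrite cardsX cards1 -cardX muln1 mulnS addnC leq_add2l.
Qed.

(** Without edges every singleton is a sink. This covers [d = 0], where redirecting a vertex would
    break the degree bound. *)
Lemma in_F0_card_sinks n (G : digraph n) : in_F 0 G -> (n <= #|sinks G|)%N.
Proof.
move=> GF; rewrite -{1}[n]card_ord -(card_imset _ (@set1_inj 'I_n)).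
apply/subset_leq_card/subsetP => _ /imsetP[v _ ->]; rewrite inE.
apply/minsetP; split=> [|B /andP[B0 _] sB].
  apply/andP; split; first by apply/set0Pn; exists v; rewrite inE.
  apply/forall_inP => w _; have := GF w; rewrite leqn0 cards_eq0 => /eqP ->.
  exact: sub0set.
by move: sB; rewrite subset1 (negbTE B0) orbF => /eqP.
Qed.

Lemma card_sinks_far (R : realType) d (eps : R) n (G : digraph n) :
  (0 < n)%N -> (eps < 1)%R -> in_F d G -> eps_far d RV eps G ->
  (eps * n%:R <= (2 * #|sinks G|)%:R)%R.
Proof.
move=> n_gt0 eps1; case: d => [|d] GF far.
  have le_n : (n <= 2 * #|sinks G|)%N by have := in_F0_card_sinks GF; lia.
  apply: (@le_trans _ _ n%:R%R); last by rewrite ler_nat.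
  by rewrite -[leRHS]mul1r ler_wpM2r // ltW.
have [H [HF HRV dH]] := RV_near n_gt0 (ltn0Sn d) GF.
have d0 : (0 < d.+1%:R :> R)%R by rewrite ltr0n.
rewrite -(ler_pM2l d0) mulrCA mulrA; apply/ltW/(lt_le_trans (far H HF HRV)).
(* The factor 2 of the statement comes from [d.+2 <= 2 * d.+1]. *)
by rewrite -natrM ler_nat; apply: (leq_trans dH); lia.
Qed.

(** Sinks are disjoint, so those with more than [M] vertices number at most [n / M]. *)
Lemma card_small_sinks n (G : digraph n) M :
  (M * #|sinks G| <= n + M * #|[set C in sinks G | #|C| <= M]|)%N.
Proof.
have -> : #|sinks G| = (#|sinks G :\: [set C : {set 'I_n} | #|C| <= M]| +
                        #|[set C in sinks G | #|C| <= M]|)%N.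
  rewrite addnC -(cardsID [set C : {set 'I_n} | #|C| <= M] (sinks G)).
  by congr (_ + _)%N; apply: eq_card => C; rewrite !inE.
rewrite mulnDr leq_add2r mulnC -sum_nat_const.
apply: (@leq_trans (\sum_(C in sinks G) #|C|)).
  rewrite [leqRHS](big_setID [set C : {set 'I_n} | #|C| <= M]) /=.
  apply: leq_trans _ (leq_addl _ _); apply: leq_sum => C; rewrite !inE.
  by case/andP; rewrite -ltnNge => /ltnW.
have := sinks_trivIset G; rewrite /trivIset => /eqP ->.
by rewrite -[X in (_ <= X)%N]card_ord max_card.
Qed.

(** * Exploration with a query budget *)

(* Setting the result to setT when the budget of m queries runs out keeps the
   result absorbing. *)
Fixpoint explored n (G : digraph n) m (D K : {set 'I_n}) : {set 'I_n} :=
  if [pick v in K :\: D] is Some v then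
    if m is m'.+1 then explored G m' (v |: D) (K :|: out_nbrs G v) else setT
  else K.

(** The decision tree computing [explored], in continuation-passing style so that explorations can
    be chained. [D] holds the queried vertices, [K] the discovered ones. *)
Fixpoint explore n m (D K : {set 'I_n}) (next : {set 'I_n} -> query_tree n) :
    query_tree n :=
  if [pick v in K :\: D] is Some v then
    if m is m'.+1
    then Query v (fun N => explore m' (v |: D) (K :|: N) next) else next setT
  else next K.

Lemma accepts_explore n (G : digraph n) m (D K : {set 'I_n}) next :
  accepts G (explore m D K next) = accepts G (next (explored G m D K)).
Proof.
by elim: m D K => [|m IHm] D K /=; case: pickP => [v _|_] //=; rewrite IHm.
Qed.

Lemma num_queries_explore n (G : digraph n) m (D K : {set 'I_n}) next :
  (num_queries G (explore m D K next)
     <= m + num_queries G (next (explored G m D K)))%N.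
Proof.
elim: m D K => [|m IHm] D K /=; case: pickP => [v _|_] //=.
  by rewrite addSn ltnS IHm.
exact: leq_addl.
Qed.

(** The invariant is that out-neighbours of queried vertices are in [K]; once all of [K] is queried,
    [K] is closed. *)
Lemma absorbing_explored n (G : digraph n) m (D K : {set 'I_n}) :
  K != set0 -> (forall v, v \in D -> out_nbrs G v \subset K) ->
  absorbing G (explored G m D K).
Proof.
have stop (D' K' : {set 'I_n}) : K' != set0 ->
    (forall v, v \in D' -> out_nbrs G v \subset K') ->
    (K' :\: D') =i pred0 -> absorbing G K'.
  move=> K0 clD KD; rewrite /absorbing K0; apply/forall_inP => v vK.
  by apply: clD; have := KD v; rewrite !inE vK andbT => /negbFE.
have setT_abs (K' : {set 'I_n}) : K' != set0 -> absorbing G setT.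
  move=> /set0Pn[x _]; apply/andP; split; first by apply/set0Pn; exists x.
  by apply/forall_inP => v _; apply: subsetT.
elim: m D K => [|m IHm] D K K0 clD /=; case: pickP => [v _|KD];
  try exact: stop clD KD; first exact: setT_abs K0.
apply: IHm => [|w].
  by case/set0Pn: K0 => x xK; apply/set0Pn; exists x; rewrite inE xK.
rewrite in_setU1 => /predU1P[-> | /clD sK]; first exact: subsetUr.
exact: subset_trans sK (subsetUl _ _).
Qed.

(** The search never leaves [C], and each query removes a vertex from [C :\: D], so the budget
    suffices. *)
Lemma explored_sub n (G : digraph n) m (D K C : {set 'I_n}) :
  absorbing G C -> K \subset C -> (#|C :\: D| <= m)%N ->
  explored G m D K \subset C.
Proof.
move=> /andP[_ /forall_inP clC].
elim: m D K => [|m IHm] D K sKC cC /=; case: pickP => [v|_] //.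
  rewrite inE => /andP[vD /(subsetP sKC) vC].
  move: cC; rewrite leqn0 cards_eq0 => /eqP/setP/(_ v).
  by rewrite !inE vD vC.
rewrite inE => /andP[vD /(subsetP sKC) vC].
apply: IHm; first by rewrite subUset sKC clC.
by move: cC; rewrite (cardsD1 v (C :\: D)) inE vD vC setDDl setUC.
Qed.

(** * Decision trees for [RV] *)

Fixpoint explore_all n m (l : seq 'I_n)
    (next : seq {set 'I_n} -> query_tree n) : query_tree n :=
  if l is v :: l' then
    explore m set0 [set v]
      (fun C => explore_all m l' (fun Cs => next (C :: Cs)))
  else next [::].

(** The conjunct [0 < n] rejects the empty digraph, which lacks [RV] and is vacuously far, although
    its list of explored sets is empty. *)
Definition RV_tree n m (l : seq 'I_n) : query_tree n :=
  explore_all m l (fun Cs =>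
    Answer n ((0 < n)%N && all2rel (fun A B : {set 'I_n} => A :&: B != set0) Cs)).

Lemma accepts_explore_all n (G : digraph n) m l next :
  accepts G (explore_all m l next) =
  accepts G (next [seq explored G m set0 [set v] | v <- l]).
Proof. by elim: l next => //= v l IHl next; rewrite accepts_explore IHl. Qed.

Lemma num_queries_RV_tree n (G : digraph n) m l :
  (num_queries G (RV_tree m l) <= m * size l)%N.
Proof.
rewrite /RV_tree; set next := fun Cs => _.
have : forall Cs, num_queries G (next Cs) = 0%N by [].
elim: l next => [|v l IHl] next next0 /=; first by rewrite next0.
apply: leq_trans (num_queries_explore _ _ _ _ _) _.
by rewrite mulnS leq_add2l; apply: IHl.
Qed.

(** A vertex reachable from everywhere lies in every absorbing set, so no two explored sets are
    disjoint. *)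
Lemma RV_tree_complete n (G : digraph n) m l :
  RV G -> accepts G (RV_tree m l).
Proof.
case=> s sP; rewrite accepts_explore_all /= (leq_ltn_trans _ (ltn_ord s)) //=.
have sIn v : s \in explored G m set0 [set v].
  have abs : absorbing G (explored G m set0 [set v]).
    apply: absorbing_explored => [|w]; last by rewrite inE.
    by apply/set0Pn; exists v; rewrite inE.
  have /andP[/set0Pn[x xE] _] := abs.
  exact: absorbing_connect abs xE (sP x).
apply/allrelP => _ _ /mapP[u _ ->] /mapP[v _ ->].
by apply/set0Pn; exists s; rewrite inE !sIn.
Qed.

(** The explorations from [u] and [v] stay within the disjoint sets [A] and [B]. *)
Lemma RV_tree_sound n (G : digraph n) m (l : seq 'I_n) A B u v :
  A \in sinks G -> B \in sinks G -> A != B ->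
  (#|A| <= m)%N -> (#|B| <= m)%N ->
  u \in A -> v \in B -> u \in l -> v \in l -> ~~ accepts G (RV_tree m l).
Proof.
move=> sA sB nAB cA cB uA vB ul vl; rewrite accepts_explore_all /= negb_and.
apply/orP; right; apply/allrelP => /(_ _ _ (map_f _ ul) (map_f _ vl)).
apply/negP; rewrite negbK -subset0.
have /trivIsetP/(_ A B sA sB nAB) := sinks_trivIset G.
rewrite -setI_eq0 -subset0; apply: subset_trans.
by apply: setISS; apply: explored_sub (sinks_absorbing _) _ _;
  rewrite ?setD0 ?sub1set.
Qed.

(** * Amplification and uniform coins *)

(** If an event has probability [b / a >= 1 / t], then [t] independent trials all miss it with
    probability at most 1/2. *)
Lemma double_exp_sub a b t :
  (0 < t)%N -> (b <= a)%N -> (a <= t * b)%N -> (2 * (a - b) ^ t <= a ^ t)%N.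
Proof.
move=> t0 ba; have [c ->] : exists c, a = (c + b)%N by exists (a - b)%N; lia.
rewrite addnK => atb.
(* Bernoulli's inequality for [(1 + b / c) ^ k], cleared of denominators. *)
have bern k : (c ^ k * (c + k * b) <= c * (c + b) ^ k)%N.
  elim: k => [|k IHk]; first by rewrite !expn0; lia.
  apply: (@leq_trans (c ^ k * (c + k * b) * (c + b))).
    rewrite expnS (mulnC c) -!mulnA leq_mul2l; apply/orP; right.
    by rewrite mulSn !mulnDr !mulnDl; lia.
  by rewrite expnSr mulnA leq_mul2r IHk orbT.
have [->|c0] := posnP c; first by rewrite exp0n.
rewrite -(leq_pmul2l c0); apply: leq_trans (bern t).
by rewrite mulnA mulnC leq_mul2l; lia.
Qed.

Lemma uniform_sum1 (R : realType) (T : finType) (c0 : T) :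
  (\sum_(c : T) (#|T|%:R)^-1 = 1 :> R)%R.
Proof.
rewrite sumr_const -[LHS]mulr_natl divff // pnatr_eq0 -lt0n.
by apply/card_gt0P; exists c0.
Qed.

Lemma uniform_ge0 (R : realType) (T : finType) (c : T) :
  (0 <= (#|T|%:R)^-1 :> R)%R.
Proof. by rewrite invr_ge0 ler0n. Qed.

Definition uniform_alg (R : realType) n (T : finType) (c0 : T)
    (strat : T -> query_tree n) : rand_alg R n :=
  RandAlg (@uniform_ge0 R T) (uniform_sum1 R c0) strat.

Lemma uniform_alg_reject (R : realType) n (G : digraph n) (T : finType)
    (c0 : T) (strat : T -> query_tree n) :
  (2 * #|[set c | accepts G (strat c)]| <= #|T|)%N ->
  (1 / 2 <= Pr_reject (uniform_alg R c0 strat) G)%R.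
Proof.
move=> half; have T_gt0 : (0 < #|T|)%N by apply/card_gt0P; exists c0.
rewrite /Pr_reject /= sumr_const -[leRHS]mulr_natl.
rewrite ler_pdivlMr ?ltr0n // mulrAC ler_pdivrMr ?ltr0n // mul1r.
rewrite -natrM ler_nat.
have := cardC (fun c => accepts G (strat c)).
move: half; rewrite cardsE; set p := #|_|; set q := #|_|.
suff -> : q = #|fun c => ~~ accepts G (strat c)| by move=> /=; lia.
by apply: eq_card.
Qed.

(** * The tester and its analysis *)

Definition pair_list n t (f : {ffun 'I_t -> 'I_n * 'I_n}) : seq 'I_n :=
  codom (fun i => (f i).1) ++ codom (fun i => (f i).2).

(** Matching on [n] provides [ord0], hence an element of the coin space of the sampling case. The
    exhaustive cases use a one-point coin space. *)
Definition RV_tester (R : realType) M n : rand_alg R n :=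
  let exhaustive m := uniform_alg R tt (fun=> RV_tree M (enum 'I_m)) in
  match n with
  | 0 => exhaustive 0%N
  | n'.+1 =>
    if (n'.+1 <= M)%N then exhaustive n'.+1 else
    uniform_alg R [ffun=> (ord0, ord0)]
      (fun f : {ffun 'I_(2 * M ^ 2) -> 'I_n'.+1 * 'I_n'.+1} =>
         RV_tree M (pair_list f))
  end.

Lemma RV_tester_strategy (R : realType) M n (c : coins (RV_tester R M n)) :
  exists2 l, strategy c = RV_tree M l & (size l <= 4 * M ^ 2)%N.
Proof.
case: n c => [|n].
  by move=> c; exists (enum 'I_0); rewrite ?size_enum_ord.
rewrite /RV_tester; case: ifP => [nM c|_ f].
  by exists (enum 'I_n.+1); rewrite // size_enum_ord; nia.
exists (pair_list f) => //.
by rewrite size_cat !size_codom card_ord; lia.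
Qed.

Lemma exhaustive_reject n (G : digraph n) M :
  (n <= M)%N -> ~ RV G -> ~~ accepts G (RV_tree M (enum 'I_n)).
Proof.
case: n G => [G _ _|n G nM notRV]; first by rewrite accepts_explore_all.
have [A [B [sA sB nAB]]] := not_RV_sinks (ltn0Sn n) notRV.
have [/set0Pn[u uA] /set0Pn[v vB]] := (sinks_neq0 sA, sinks_neq0 sB).
have small (C : {set 'I_n.+1}) : (#|C| <= M)%N.
  by apply: leq_trans (max_card _) _; rewrite card_ord.
by apply: (RV_tree_sound sA sB nAB _ _ uA vB); rewrite ?mem_enum.
Qed.

Lemma sampled_reject n (G : digraph n) M :
  (M < n)%N -> (n < M * #|[set C in sinks G | #|C| <= M]|)%N ->
  (2 * #|[set f : {ffun 'I_(2 * M ^ 2) -> 'I_n * 'I_n} |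
           accepts G (RV_tree M (pair_list f))]|
     <= #|{ffun 'I_(2 * M ^ 2) -> 'I_n * 'I_n}|)%N.
Proof.
set S := [set C in _ | _] => Mn nMS.
have sS : S \subset sinks G by apply/subsetP => C; rewrite inE => /andP[].
have [X [cardX _ sepX]] := exists_transversal sS.
(* [D] consists of the ordered pairs of distinct representatives; an accepting sample must avoid [D]
   in every coordinate. *)
pose D := setX X X :\: [set (x, x) | x in X].
have cardD : (#|S| * #|S| - #|S| <= #|D|)%N.
  rewrite cardsD cardsX cardX leq_sub2l // -cardX.
  by apply: leq_trans (subset_leq_card (subsetIr _ _)) (leq_imset_card _ _).
have D_le : (#|D| <= n * n)%N.
  by apply: leq_trans (max_card _) _; rewrite card_prod card_ord.
have acc_sub : [set f : {ffun 'I_(2 * M ^ 2) -> 'I_n * 'I_n} |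
    accepts G (RV_tree M (pair_list f))] \subset ffun_on (~: D).
  apply/subsetP => f; rewrite inE => acc; apply/ffun_onP => i.
  rewrite inE; apply: contraL acc.
  case defi: (f i) => [x y]; rewrite !inE /= => /andP[nd /andP[xX yX]].
  have nxy : x != y by apply: contra nd => /eqP <-; apply: imset_f.
  have [A [B [SA SB nAB xA yB]]] := sepX x y xX yX nxy.
  move: SA SB; rewrite !inE => /andP[sA cA] /andP[sB cB].
  apply: (RV_tree_sound _ _ nAB cA cB xA yB); rewrite ?inE //.
    by rewrite mem_cat; apply/orP; left; apply/codomP; exists i; rewrite defi.
  by rewrite mem_cat; apply/orP; right; apply/codomP; exists i; rewrite defi.
rewrite card_ffun card_prod !card_ord.
have := subset_leq_card acc_sub; rewrite card_ffun_on card_ord => le_acc.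
apply: leq_trans (double_exp_sub _ D_le _); last first.
- move: cardD nMS; move: #|S| #|D| => k N; rewrite -mulnn => kN nMk.
  (* From [M < n < M * k]. Then [k * k - k] is at least half of [k * k], whence the factor 2 in the
     number of samples. *)
  have k2 : (2 <= k)%N by nia.
  have h1 : (k * k <= 2 * N)%N by nia.
  have h2 : (n * n <= (M * k) * (M * k))%N by apply: leq_mul; apply: ltnW.
  apply: (leq_trans h2).
  by rewrite mulnACA (mulnC 2) -[X in (_ <= X)%N]mulnA leq_mul2l h1 orbT.
- by nia.
rewrite leq_mul2l /=; apply: leq_trans le_acc _.
by rewrite cardsCs setCK card_prod card_ord.
Qed.

Theorem theorem5p1 (R : realType) (d : nat) :
  one_sided_strongly_testable R d RV.
Proof.
(* At most [4 * M ^ 2] explorations of at most [M] queries each. The bound [eps * M > 4] leaves more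
   than [n / M] small sinks. *)
exists (fun eps => let M := Num.bound (4%:R / eps)%R in M * (4 * M ^ 2))%N.
move=> eps /andP[eps0 eps1]; set M := Num.bound _.
exists (RV_tester R M); split=> [n G GF|n G GF c]; last first.
  have [l -> sl] := RV_tester_strategy c.
  by apply: leq_trans (num_queries_RV_tree _ _ _) _; rewrite leq_mul2l sl orbT.
split=> [HRV|far].
  rewrite /Pr_accept -(weight_sum1 (RV_tester R M n)); apply: eq_bigl => c.
  by have [l -> _] := RV_tester_strategy c; apply: RV_tree_complete.
have notRV : (0 < n)%N -> ~ RV G.
  move=> n_gt0 /(far G GF); rewrite /edit_dist setDv setU0 cards0.
  by apply/negP; rewrite -leNgt !mulr_ge0 ?ler0n // ltW.
have not_acc : (n <= M)%N -> ~~ accepts G (RV_tree M (enum 'I_n)).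
  by move=> nM; apply: exhaustive_reject => // HRV;
     apply: (notRV _ HRV); case: HRV => s _; apply: leq_ltn_trans (ltn_ord s).
have exhaustive : (n <= M)%N ->
    (1 / 2 <= Pr_reject (uniform_alg R tt (fun=> RV_tree M (enum 'I_n))) G)%R.
  move=> nM; apply: uniform_alg_reject; rewrite card_unit.
  suff -> : [set c : unit | accepts G (RV_tree M (enum 'I_n))] = set0.
    by rewrite cards0.
  by apply/setP => c; rewrite !inE (negbTE (not_acc nM)).
case: n G GF far {notRV not_acc} exhaustive => [|n] G GF far exhaustive.
  exact: exhaustive.
rewrite /RV_tester; case: ifP => [|nM]; first exact: exhaustive.
apply/uniform_alg_reject/sampled_reject; first by rewrite ltnNge nM.
have epsM : (4 < eps * M%:R)%R.
  by rewrite mulrC -ltr_pdivrMr // archi_boundP // divr_ge0 ?ler0n // ltW.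
have many := card_sinks_far (ltn0Sn n) eps1 GF far.
have : (4 * n.+1%:R < (2 * #|sinks G|)%:R * M%:R :> R)%R.
  apply: (@lt_le_trans _ _ (eps * M%:R * n.+1%:R)%R).
    by rewrite ltr_pM2r // ltr0n.
  by rewrite mulrAC ler_wpM2r // ler0n.
(* Now [M * #|sinks G|] exceeds [2 * n.+1], and large sinks account for at most [n.+1] of it. *)
rewrite -!natrM ltr_nat; have := card_small_sinks G M; nia.
Qed.
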